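(* Let $s \in (0,1)$ and let $\{\mu(I)\}_{I\in\mathcal D}$ be a family of nonnegative real numbers. Then there is a constant $C<\infty$ such that $$\sum_{I\in\mathcal D}\langle f\rangle_I^2\,\mu(I)\le C\,\|f\|_{H^s}^2\qquad\text{for all } f\in H^s$$ if and only if $\{\mu(I)\}_{I\in\mathcal D}$ is an $s$-Carleson sequence. Moreover, $\|\mu\|_{sC}^2$ is comparable to the infimum over all admissible constants $C$ in the inequality $\sum_{I\in\mathcal D}\langle f\rangle_I^2\,\mu(I)\le C\,\|f\|_{H^s}^2$ (required for all $f\in H^s$), with comparability constants independent of $\mu$ (they may depend on $s$).
   Context: All functions are real-valued and defined on $I_0=[0,1]$; $L^p=L^p([0,1])$; $(f,g)=\int_{I_0} f(x)g(x)\,dx$; $\langle f\rangle_I=|I|^{-1}\int_I f(x)\,dx$. Dyadic system: $\mathcal D=\{2^{-j}([0,1)+k): j=0,1,2,\dots,\ k=0,\dots,2^j-1\}$; the top interval $[0,1)$ is identified with $I_0$. For $I\in\mathcal D$, $I_-,I_+$ are its left and right halves, $h_I=|I|^{-1/2}(\mathbb 1_{I_-}-\mathbb 1_{I_+})$, and $\mathcal D(I)=\{J\in\mathcal D: J\subseteq I\}$. Local dyadic fractional Sobolev space: $D^sf=\sum_{I\in\mathcal D}|I|^{-s}(f,h_I)h_I$, and $H^s$ is the set of $f\in L^2$ with $\|f\|_{H^s}^2:=\|D^sf\|_{L^2}^2+\|f\|_{L^2}^2<\infty$, where $\|D^sf\|_{L^2}^2=\sum_{I\in\mathcal D}|I|^{-2s}|(f,h_I)|^2$.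 Dyadic Sobolev $s$-capacity: for $E\subseteq I_0$, $\mathrm{Cap}_s(E)=\inf\{\|f\|_{H^s}^2: f\in H^s,\ f\ge 1 \text{ a.e. on } E\}$ (equal to $\infty$ if no such $f$ exists). A family $\{\mu(I)\}_{I\in\mathcal D}$ of nonnegative reals is an $s$-Carleson sequence if $$\|\mu\|_{sC}:=\sup_{\{I_k\}_{k=1}^n}\Big(\frac{1}{\mathrm{Cap}_s(\bigcup_{k=1}^n I_k)}\sum_{k=1}^n\sum_{J\in\mathcal D(I_k)}\mu(J)\Big)^{1/2}<\infty,$$ the supremum being over all nonempty finite collections of pairwise disjoint intervals $\{I_k\}_{k=1}^n\subseteq\mathcal D$. *)

(* Defs.v *)
From HB Require Import structures.
From mathcomp Require Import all_boot all_order all_algebra.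
From mathcomp Require Import all_classical all_reals all_analysis.
Set Implicit Arguments.
Unset Strict Implicit.
Unset Printing Implicit Defensive.
Import Order.TTheory GRing.Theory Num.Theory.
Import numFieldNormedType.Exports.
Local Open Scope classical_set_scope.
Local Open Scope ring_scope.

Notation unit_itv R := (`[(0 : R), (1 : R)]%classic).

(* The pair (j, k) with k < 2 ^ j stands for the interval 2^-j ([0, 1) + k);
   distinct pairs give distinct intervals. *)
Notation dyadic := {j : nat & 'I_(2 ^ j)}.

Definition dlen (R : realType) (I : dyadic) : R := 2 ^- tag I.

Definition dleft (R : realType) (I : dyadic) : R :=
  dlen R I * (nat_of_ord (tagged I))%:R.

Definition dset (R : realType) (I : dyadic) : set R :=
  `[dleft R I, (dleft R I + dlen R I)[.
Arguments dset R I : clear implicits.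

Definition dset_minus (R : realType) (I : dyadic) : set R :=
  `[dleft R I, (dleft R I + dlen R I / 2)[.
Arguments dset_minus R I : clear implicits.

Definition dset_plus (R : realType) (I : dyadic) : set R :=
  `[(dleft R I + dlen R I / 2), (dleft R I + dlen R I)[.
Arguments dset_plus R I : clear implicits.

Definition dsub (R : realType) (I : dyadic) : set dyadic :=
  [set J | dset R J `<=` dset R I].

Definition haar (R : realType) (I : dyadic) (x : R) : R :=
  dlen R I `^ (- 2^-1) * (\1_(dset_minus R I) x - \1_(dset_plus R I) x).

(* Functions on [0, 1] are represented by functions R -> R; none of the notions
   below depends on their values outside [0, 1]. *)
Definition inner (R : realType) (f g : R -> R) : R :=
  \int[lebesgue_measure]_(x in unit_itv R) (f x * g x).

Definition avg (R : realType) (f : R -> R) (I : dyadic) : R :=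
  (dlen R I)^-1 * \int[lebesgue_measure]_(x in dset R I) f x.

Definition L2norm2 (R : realType) (f : R -> R) : \bar R :=
  (\int[lebesgue_measure]_(x in unit_itv R) ((f x) ^+ 2)%:E)%E.

Definition in_L2 (R : realType) (f : R -> R) : Prop :=
  measurable_fun (unit_itv R) f /\ (L2norm2 f < +oo)%E.

(* The squared L^2 norm of D^s f = \sum_I |I|^(-s) (f, h_I) h_I. *)
Definition Dsnorm2 (R : realType) (s : R) (f : R -> R) : \bar R :=
  \esum_(I in [set: dyadic])
    (dlen R I `^ (- (2 * s)) * `|inner f (haar I)| ^+ 2)%:E.

Definition Hnorm2 (R : realType) (s : R) (f : R -> R) : \bar R :=
  (Dsnorm2 s f + L2norm2 f)%E.

Definition in_H (R : realType) (s : R) (f : R -> R) : Prop :=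
  in_L2 f /\ (Hnorm2 s f < +oo)%E.

Definition Cap (R : realType) (s : R) (E : set R) : \bar R :=
  ereal_inf [set Hnorm2 s f | f in
    [set f : R -> R | in_H s f /\
       {ae @lebesgue_measure R, forall x, E x -> 1 <= f x}]].

Definition sCnorm (R : realType) (s : R) (mu : dyadic -> R) : \bar R :=
  ereal_sup [set r : \bar R | exists (n : nat) (I : 'I_n.+1 -> dyadic),
    trivIset setT (fun k => dset R (I k)) /\
    r = (((Cap s (\bigcup_k dset R (I k)))^-1 *
          \sum_(k < n.+1) \esum_(J in dsub R (I k)) (mu J)%:E) `^ 2^-1)%E].

Definition is_sCarleson (R : realType) (s : R) (mu : dyadic -> R) : Prop :=
  (sCnorm s mu < +oo)%E.

Definition embedding (R : realType) (s : R) (mu : dyadic -> R) (C : R) : Prop :=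
  forall f : R -> R, in_H s f ->
    (\esum_(I in [set: dyadic]) ((avg f I) ^+ 2 * mu I)%:E
       <= C%:E * Hnorm2 s f)%E.

(* +oo when no constant is admissible. *)
Definition best_const (R : realType) (s : R) (mu : dyadic -> R) : \bar R :=
  ereal_inf [set C%:E | C in [set C : R | embedding s mu C]].

(* Main.v *)
Require Import Defs.
From mathcomp Require Import all_boot all_order all_algebra.
From mathcomp Require Import all_classical all_reals all_analysis.
From mathcomp Require Import measurable_realfun ring lra zify.

(** Fix p = 2^s > 1. A function b of a generation k and an index i is read as
    a function on the dyadic tree: the node (k, i) is the interval
    2^-k ([0, 1) + i), its parent is (k - 1, i./2) and its children are
    (k + 1, i.*2) and (k + 1, i.*2.+1). The proof is carried by one discrete
    quantity, the energy

      b(root)^2 + \sum_(I <> root) |I|^(1 - 2s) (b(I) - b(parent I))^2,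

    which is linked to the Sobolev norm in two ways. When b(I) is the average
    of f over I, the Haar coefficients of f are differences of averages over
    siblings, and the energy is at most a multiple of the squared norm of f
    ([energy_dyadic_avg_le]). Conversely, take any tree function b, not
    necessarily made of averages: the step function with the values of b at
    generation N has squared norm at most a multiple of the energy of b
    ([step_fun_H]). This is a Hardy inequality; it holds because the weights
    p^(2k) of successive generations grow geometrically.

    One half of the equivalence is direct: if f >= 1 on disjoint dyadic
    intervals, then the averages of f over all their dyadic subintervals are at
    least 1, so the embedding inequality for f bounds the mass of mu below
    these intervals by C times the squared norm of f; take the infimum over f
    ([carleson_bound_of_embedding]).

    The other half is a capacitary strong type inequality. Only the intervals
    of generation at most N are considered, with bounds independent of N. Let
    a(I) be the average of f over I, and m(I) the maximum of |a| over the
    intervals containing I. Replacing a by m does not increase the energy, since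
    where m grows from a parent to its child it grows by at most the increment
    of a ([branch_max_jump]). Cutting the values of m into the slices [t, 2t],
    for t = e, 2e, 4e, and so on, yields tree functions whose energies sum to at
    most that of m ([sum_slice_lipschitz]). The slice at t, divided by t, equals
    1 wherever m >= 2t, so its step function is a competitor for the capacity of
    {m > 2t}. This set is the disjoint union of the maximal intervals with
    |a| > 2t, and the Carleson condition for them bounds the mass of all the
    intervals with |a(I)| > 2t by the energy of the slice over t^2
    ([level_mass_le]). Multiplying by t^2 and summing over t gives
    \sum_I a(I)^2 mu(I) up to a constant factor ([sum_sqr_tree_le],
    [embedding_of_carleson_bound]). *)

Set Implicit Arguments.
Unset Strict Implicit.
Import Order.TTheory GRing.Theory Num.Theory.
Import numFieldNormedType.Exports.
Local Open Scope classical_set_scope.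
Local Open Scope ring_scope.

(** * Energy of tree functions *)

Section tree.
Context {R : realFieldType}.
Implicit Types (b phi psi : nat -> nat -> R) (p c : R) (N n j k i : nat).

Lemma exp2V_gt0 n : 0 < 2 ^- n :> R.
Proof. by rewrite invr_gt0 exprn_gt0. Qed.

Lemma exp2V_ge0 n : 0 <= 2 ^- n :> R.
Proof. exact/ltW/exp2V_gt0. Qed.

#[local] Hint Resolve exp2V_gt0 exp2V_ge0 : core.

Lemma sum_children n (F : nat -> R) :
  \sum_(i < n.*2) F i = \sum_(i < n) (F i.*2 + F i.*2.+1).
Proof.
elim: n => [|n IHn]; first by rewrite !big_ord0.
by rewrite doubleS !big_ord_recr /= IHn addrA.
Qed.

Lemma sum_children_expn k (F : nat -> R) :
  \sum_(i < 2 ^ k.+1) F i = \sum_(i < 2 ^ k) (F i.*2 + F i.*2.+1).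
Proof. by rewrite expnS mul2n sum_children. Qed.

(** The squared L^2 distance between the step functions of [b] at generations k
    and k + 1. *)
Definition jump b k : R :=
  2 ^- k.+1 * \sum_(i < 2 ^ k.+1) (b k.+1 i - b k i./2) ^+ 2.

(** At p = 2^s the factor p^(2(k + 1)) 2^-(k + 1) is |I|^(1 - 2s), for I of
    generation k + 1. *)
Definition energy p N b : R :=
  b 0%N 0%N ^+ 2 + \sum_(k < N) p ^+ (2 * k.+1) * jump b k.

Lemma jump_ge0 b k : 0 <= jump b k.
Proof. by rewrite mulr_ge0 ?sumr_ge0// => i _; rewrite sqr_ge0. Qed.

Lemma energyZ p N c b :
  energy p N (fun k i => c * b k i) = c ^+ 2 * energy p N b.
Proof.
rewrite /energy mulrDr exprMn; congr (_ + _); rewrite mulr_sumr.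
apply: eq_bigr => k _; rewrite [RHS]mulrCA; congr (_ * _).
rewrite /jump mulrCA; congr (_ * _); rewrite mulr_sumr.
by apply: eq_bigr => i _; rewrite -exprMn mulrBr.
Qed.

(** The energy is a sum of squares of increments, so a splitting of a tree
    function that is square-summable on each increment is so for energies. *)
Lemma energy_sum_le p N n (B : nat -> nat -> nat -> R) b : 0 <= p ->
  \sum_(r < n) B r 0%N 0%N ^+ 2 <= b 0%N 0%N ^+ 2 ->
  (forall k i, \sum_(r < n) (B r k.+1 i - B r k i./2) ^+ 2
     <= (b k.+1 i - b k i./2) ^+ 2) ->
  \sum_(r < n) energy p N (B r) <= energy p N b.
Proof.
move=> p0 B0 B1; rewrite big_split/= lerD// exchange_big/=.
apply: ler_sum => k _; rewrite -mulr_sumr ler_wpM2l ?exprn_ge0//.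
rewrite /jump -mulr_sumr ler_wpM2l// exchange_big/=.
by apply: ler_sum => i _; exact: B1.
Qed.

(** * Averages over leaves and the Hardy inequality *)

(** Only the values of [phi] at generation j + n matter. *)
Fixpoint leaf_avg n phi j i : R :=
  if n is n'.+1 then (leaf_avg n' phi j.+1 i.*2 + leaf_avg n' phi j.+1 i.*2.+1) / 2
  else phi j i.

Lemma le_leaf_avg n phi psi j i : (forall j i, phi j i <= psi j i) ->
  leaf_avg n phi j i <= leaf_avg n psi j i.
Proof.
move=> h; elim: n j i => [|n IHn] j i //=.
by rewrite ler_pM2r ?invr_gt0// lerD.
Qed.

Lemma leaf_avg_affine n phi c c' j i :
  leaf_avg n (fun j i => c * phi j i + c') j i = c * leaf_avg n phi j i + c'.
Proof. by elim: n j i => [|n IHn] j i //=; rewrite !IHn; field. Qed.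

Definition spread b n c j i : R := leaf_avg n (fun j i => (b j i - c) ^+ 2) j i.

Lemma spread_ge0 b n c j i : 0 <= spread b n c j i.
Proof.
rewrite /spread; elim: n j i => [|n IHn] j i /=; first exact: sqr_ge0.
by rewrite divr_ge0 ?addr_ge0.
Qed.

Lemma sqr_leaf_avg_le n b c j i : (leaf_avg n b j i - c) ^+ 2 <= spread b n c j i.
Proof.
rewrite /spread; elim: n j i => [|n IHn] j i //=.
have := IHn j.+1 i.*2; have := IHn j.+1 i.*2.+1.
move: (leaf_avg n _ _ _) (leaf_avg n _ _ _) (leaf_avg n _ _ _) (leaf_avg n _ _ _).
move=> x u y v.
by move=> h1 h2; have := sqr_ge0 (u - v); nra.
Qed.

(** Cauchy-Schwarz for a Haar coefficient: the function is tested against a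
    function of mean zero, so any constant [c] may be subtracted from it. *)
Lemma sqr_leaf_avg_sub_le n b c j i :
  (leaf_avg n b j.+1 i.*2 - leaf_avg n b j.+1 i.*2.+1) ^+ 2 <= 4 * spread b n.+1 c j i.
Proof.
have := sqr_leaf_avg_le n b c j.+1 i.*2; have := sqr_leaf_avg_le n b c j.+1 i.*2.+1.
rewrite /spread /=.
move: (leaf_avg n _ _ _) (leaf_avg n _ _ _) (leaf_avg n _ _ _) (leaf_avg n _ _ _).
move=> x u y v.
by move=> h1 h2; have := sqr_ge0 (u + v - 2 * c); nra.
Qed.

Lemma sqr_le_peter_paul p (x y : R) : 1 < p ->
  (x + y) ^+ 2 <= p * x ^+ 2 + p / (p - 1) * y ^+ 2.
Proof.
move=> p1; have p10 : 0 < p - 1 by rewrite subr_gt0.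
have -> : p * x ^+ 2 + p / (p - 1) * y ^+ 2 =
    (x + y) ^+ 2 + ((p - 1) * x - y) ^+ 2 / (p - 1).
  by field; rewrite gt_eqF.
by rewrite lerDl divr_ge0 ?sqr_ge0 ?ltW.
Qed.

(** The factor p in front is affordable, because it is smaller than the ratio
    p^2 between the weights of successive generations. *)
Lemma spread_recenter p n b c c' j i : 1 < p ->
  spread b n c j i <= p * spread b n c' j i + p / (p - 1) * (c' - c) ^+ 2.
Proof.
move=> p1; rewrite /spread -leaf_avg_affine; apply: le_leaf_avg => {}j {}i.
have -> : b j i - c = (b j i - c') + (c' - c) by rewrite addrA subrK.
exact: sqr_le_peter_paul.
Qed.

(** The squared L^2 distance between the step functions of [b] at generations N
    and j. *)
Definition osc b N j : R :=
  2 ^- j * \sum_(i < 2 ^ j) spread b (N - j) (b j i) j i.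

Lemma osc_ge0 b N j : 0 <= osc b N j.
Proof. by rewrite mulr_ge0 ?sumr_ge0// => i _; exact: spread_ge0. Qed.

Lemma osc_last b N : osc b N N = 0.
Proof.
rewrite /osc subnn big1 ?mulr0// => i _.
by rewrite /spread /= subrr expr0n.
Qed.

(** Pass from the values of [b] at generation j to those at generation j + 1,
    on each interval of generation j + 1 separately. *)
Lemma osc_step p b N j : 1 < p -> (j < N)%N ->
  osc b N j <= p * osc b N j.+1 + p / (p - 1) * jump b j.
Proof.
move=> p1 jN; rewrite /osc /jump.
rewrite (sum_children_expn j (fun i => spread b (N - j.+1) (b j.+1 i) j.+1 i)).
rewrite (sum_children_expn j (fun i => (b j.+1 i - b j i./2) ^+ 2)).
rewrite [X in _ <= X + _]mulrCA [X in _ <= _ + X]mulrCA -mulrDr.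
rewrite exprS invfM [X in _ <= X * _]mulrC -mulrA ler_wpM2l//.
rewrite !mulr_sumr -big_split/= mulr_sumr; apply: ler_sum => i _.
rewrite -(subnSK jN); move: (N - j.+1)%N => n.
rewrite {1}/spread /= doubleK uphalf_double.
have := spread_recenter n b (b j i) (b j.+1 i.*2) j.+1 i.*2 p1.
have := spread_recenter n b (b j i) (b j.+1 i.*2.+1) j.+1 i.*2.+1 p1.
by rewrite /spread; lra.
Qed.

(** Hardy inequality. Weighting [osc_step] by p^(2j) and summing, the terms
    in [osc] on the right reproduce 1/p times the left side, which is
    absorbed since p > 1. *)
Lemma sum_osc_le p b N : 1 < p ->
  \sum_(j < N) p ^+ (2 * j) * osc b N j
    <= (p - 1) ^- 2 * \sum_(j < N) p ^+ (2 * j.+1) * jump b j.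
Proof.
move=> p1; have p0 : 0 < p by exact: lt_trans p1.
have p10 : 0 < p - 1 by rewrite subr_gt0.
set X := \sum_(j < N) _; set D := \sum_(j < N) _.
(* [osc b N N] vanishes, so shifting the index only drops the term j = 0. *)
have shift : \sum_(j < N) p ^+ (2 * j.+1) * osc b N j.+1 <= X.
  have : \sum_(j < N.+1) p ^+ (2 * j) * osc b N j = X.
    by rewrite big_ord_recr/= osc_last mulr0 addr0.
  rewrite big_ord_recl/= muln0 expr0 mul1r => <-.
  by rewrite lerDr osc_ge0.
have : X <= p^-1 * X + (p * (p - 1))^-1 * D.
  apply: (@le_trans _ _ (p^-1 * (\sum_(j < N) p ^+ (2 * j.+1) * osc b N j.+1)
                         + (p * (p - 1))^-1 * D)); last first.
    by rewrite lerD2r ler_wpM2l// invr_ge0 ltW.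
  rewrite !mulr_sumr -big_split/=; apply: ler_sum => j _.
  have -> : p^-1 * (p ^+ (2 * j.+1) * osc b N j.+1) +
      (p * (p - 1))^-1 * (p ^+ (2 * j.+1) * jump b j) =
      p ^+ (2 * j) * (p * osc b N j.+1 + p / (p - 1) * jump b j).
    rewrite mulnS exprD; field.
    by rewrite !gt_eqF.
  by rewrite ler_wpM2l ?exprn_ge0 ?(ltW p0)// osc_step.
have -> : p^-1 * X + (p * (p - 1))^-1 * D = (X + (p - 1)^-1 * D) / p.
  by field; rewrite !gt_eqF.
rewrite ler_pdivlMr// => h.
have : (p - 1) * X <= (p - 1)^-1 * D by lra.
by rewrite mulrC -ler_pdivlMr// mulrAC -invfM -expr2.
Qed.

Lemma leaf_avg_sqr_le n b : leaf_avg n (fun j i => b j i ^+ 2) 0%N 0%N <=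
  2 * osc b n 0 + 2 * b 0%N 0%N ^+ 2.
Proof.
rewrite /osc expr0 invr1 mul1r expn0 big_ord1 subn0 /= /spread -leaf_avg_affine.
by apply: le_leaf_avg => j i; have := sqr_ge0 (b j i - 2 * b 0%N 0%N); nra.
Qed.

(** * Running maxima along branches *)

Fixpoint branch_max b k i : R :=
  if k is k'.+1 then Num.max (branch_max b k' i./2) `|b k i| else `|b 0%N i|.

Lemma branch_max_ge b k i : `|b k i| <= branch_max b k i.
Proof. by case: k => [|k] //=; rewrite le_max lexx orbT. Qed.

Lemma branch_maxS b k i : branch_max b k i./2 <= branch_max b k.+1 i.
Proof. by rewrite /= le_max lexx. Qed.

(** When the running maximum grows, its new value is the absolute value of [b]
    at the child, while the old one is at least that of [b] at the parent. *)
Lemma branch_max_jump b k i :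
  (branch_max b k.+1 i - branch_max b k i./2) ^+ 2 <= (b k.+1 i - b k i./2) ^+ 2.
Proof.
rewrite /=; set m := branch_max b k i./2.
have h : `|b k i./2| <= m by exact: branch_max_ge.
have [le1|lt1] := leP m `|b k.+1 i|; last by rewrite subrr expr0n /= sqr_ge0.
rewrite -(real_normK (num_real (b k.+1 i - b k i./2))) ler_pXn2r ?nnegrE ?subr_ge0//.
by apply: le_trans (lerB_dist _ _); rewrite lerD2l lerN2.
Qed.

Lemma energy_branch_max p N b : 0 <= p ->
  energy p N (branch_max b) <= energy p N b.
Proof.
move=> p0; have := @energy_sum_le p N 1 (fun=> branch_max b) b p0.
rewrite !big_ord1 /=; apply; first by rewrite real_normK ?num_real.
by move=> k i; rewrite big_ord1; exact: branch_max_jump.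
Qed.

(** * Slices *)

(** For x >= 0, the length of the intersection of [0, x] and [t, 2t]. *)
Definition slice (t x : R) := Num.min x (2 * t) - Num.min x t.

Lemma slice_le t x y : 0 < t -> x <= y -> slice t x <= slice t y.
Proof.
move=> t0 xy; rewrite /slice.
by case: (leP x t); case: (leP x (2 * t)); case: (leP y t); case: (leP y (2 * t)); lra.
Qed.

Lemma slice0 t : 0 < t -> slice t 0 = 0.
Proof.
by move=> t0; rewrite /slice; case: (leP 0 t); case: (leP 0 (2 * t)); lra.
Qed.

Lemma slice_top t x : 0 < t -> 2 * t <= x -> slice t x = t.
Proof.
by move=> t0 tx; rewrite /slice; case: (leP x t); case: (leP x (2 * t)); lra.
Qed.

Lemma sum_sqr_le n (d : nat -> R) : (forall r, 0 <= d r) ->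
  \sum_(r < n) d r ^+ 2 <= (\sum_(r < n) d r) ^+ 2.
Proof.
move=> d0; elim: n => [|n IHn]; first by rewrite !big_ord0 expr0n.
rewrite !big_ord_recr/= sqrrD; have : 0 <= \sum_(i < n) d i by exact: sumr_ge0.
by have := d0 n; move: IHn; nra.
Qed.

(** All the increments of the slices have the same sign, so the sum of their
    squares is at most the square of their sum, which telescopes. *)
Lemma sum_slice_lipschitz n e x y : 0 < e ->
  \sum_(r < n) (slice (e * 2 ^+ r) x - slice (e * 2 ^+ r) y) ^+ 2 <= (x - y) ^+ 2.
Proof.
move=> e0; wlog xy : x y / y <= x => [hw|].
  have [/hw//|/ltW/hw h] := leP y x.
  rewrite -[X in _ <= X]sqrrN opprB; apply: le_trans h; apply: ler_sum => r _.
  by rewrite -sqrrN opprB.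
have er r : 0 < e * 2 ^+ r by rewrite mulr_gt0 ?exprn_gt0.
pose d r := slice (e * 2 ^+ r) x - slice (e * 2 ^+ r) y.
apply: le_trans (sum_sqr_le (d := d) n _) _.
  by move=> r; rewrite subr_ge0 slice_le.
have -> : \sum_(r < n) (slice (e * 2 ^+ r) x - slice (e * 2 ^+ r) y) =
   (Num.min x (e * 2 ^+ n) - Num.min y (e * 2 ^+ n)) - (Num.min x e - Num.min y e).
  elim: n => [|n IHn]; first by rewrite big_ord0 expr0 mulr1 subrr.
  by rewrite big_ord_recr/= IHn /slice exprS [e * (2 * _)]mulrCA; ring.
have : e <= e * 2 ^+ n by rewrite ler_peMr ?exprn_ege1 ?ler1n ?(ltW e0).
move: (e * 2 ^+ n) => u eu.
rewrite ler_pXn2r ?nnegrE//; try lra.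
all: case: (leP x u); case: (leP x e); case: (leP y u); case: (leP y e); lra.
Qed.
End tree.

#[local] Hint Resolve exp2V_gt0 exp2V_ge0 : core.

(** * Dyadic intervals *)

Section intervals.
Context {R : realType}.
Implicit Types (f : R -> R) (N n j k i : nat) (x : R).
Local Notation leb := (@lebesgue_measure R).

Definition dyadic_itv k i : set R :=
  `[2 ^- k * i%:R, (2 ^- k * i%:R + 2 ^- k)[%classic.

(** The index of the interval of generation k that contains [x], for x >= 0. *)
Definition dyadic_idx k x : nat := Num.truncn (2 ^+ k * x).

Lemma dyadic_itvP k i x : dyadic_itv k i x <-> 0 <= x /\ dyadic_idx k x = i.
Proof.
have p0 : 0 < 2 ^+ k :> R by rewrite exprn_gt0.
have e : 2 ^- k * i%:R + 2 ^- k = i.+1%:R / 2 ^+ k :> R.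
  by rewrite -(natr1 i) mulrDl mul1r mulrC.
rewrite /dyadic_itv /= in_itv /= e [2 ^- k * _]mulrC ler_pdivrMr// ltr_pdivlMr//.
rewrite mulrC /dyadic_idx; split => [/[dup] xi /andP[ix _]|[x0 <-]].
  have x0 : 0 <= x by rewrite -(pmulr_rge0 _ p0) (le_trans _ ix).
  by split => //; exact: truncn_def.
by apply: truncn_itv; rewrite mulr_ge0 // ltW.
Qed.

Lemma dyadic_idx_half k x : 0 <= x -> dyadic_idx k x = (dyadic_idx k.+1 x)./2.
Proof.
move=> x0; rewrite /dyadic_idx exprS -mulrA.
have : 0 <= 2 ^+ k * x by rewrite mulr_ge0.
move: (2 ^+ k * x) => y y0; apply: truncn_def.
have /truncn_itv := mulr_ge0 (ler0n R 2) y0.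
set m := Num.truncn _ => /andP[m1 m2].
have := odd_double_half m; set h := m./2 => mE.
have -> : y = 2 * y / 2 by rewrite mulrC mulKf.
rewrite ler_pdivlMr// ltr_pdivrMr// -!natrM; apply/andP; split.
  by apply: le_trans m1; rewrite ler_nat; lia.
by apply: lt_le_trans m2 _; rewrite ler_nat; case: (odd m) mE; lia.
Qed.

Lemma dyadic_idx_lt k x : 0 <= x < 1 -> (dyadic_idx k x < 2 ^ k)%N.
Proof.
move=> /andP[x0 x1]; rewrite /dyadic_idx.
have p0 : 0 < 2 ^+ k :> R by rewrite exprn_gt0.
have /truncn_itv/andP[h _] : 0 <= 2 ^+ k * x by rewrite mulr_ge0// ltW.
rewrite -(ltr_nat R) natrX; apply: le_lt_trans h _.
by rewrite -[ltRHS]mulr1 ltr_pM2l.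
Qed.

Lemma dyadic_itv_children k i :
  dyadic_itv k i = dyadic_itv k.+1 i.*2 `|` dyadic_itv k.+1 i.*2.+1.
Proof.
apply/seteqP; split => x.
  move=> /dyadic_itvP[x0]; rewrite (dyadic_idx_half k x0) => hi.
  have := odd_double_half (dyadic_idx k.+1 x); case: odd => /= h.
    by right; apply/dyadic_itvP; split => //; lia.
  by left; apply/dyadic_itvP; split => //; lia.
case=> /dyadic_itvP[x0 h]; apply/dyadic_itvP; split => //; rewrite dyadic_idx_half// h.
  by rewrite doubleK.
by rewrite /= uphalf_double.
Qed.

Lemma dyadic_itv_parent k i : dyadic_itv k.+1 i `<=` dyadic_itv k i./2.
Proof.
move=> x /dyadic_itvP[x0 h]; apply/dyadic_itvP; split => //.
by rewrite dyadic_idx_half// h.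
Qed.

Lemma dyadic_itv_disjoint k i i' :
  i != i' -> [disjoint dyadic_itv k i & dyadic_itv k i'].
Proof.
move=> ii'; apply/disj_setPS => x [/dyadic_itvP[_ h] /dyadic_itvP[_ h']].
by move: ii'; rewrite -h -h' eqxx.
Qed.

Lemma measurable_dyadic_itv k i : measurable (dyadic_itv k i).
Proof. exact: measurable_itv. Qed.

Lemma lebesgue_dyadic_itv k i : leb (dyadic_itv k i) = (2 ^- k)%:E.
Proof.
by rewrite lebesgue_measure_itv/= lte_fin ltrDl exp2V_gt0 -EFinD addrAC subrr add0r.
Qed.

Lemma dyadic_itv_lt1 k i x : (i < 2 ^ k)%N -> dyadic_itv k i x -> 0 <= x < 1.
Proof.
move=> ik /dyadic_itvP[x0 xi]; rewrite x0 /= ltNge; apply/negP => x1.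
have p0 : 0 < 2 ^+ k :> R by rewrite exprn_gt0.
have /truncn_itv/andP[_] : 0 <= 2 ^+ k * x by rewrite mulr_ge0// ltW.
rewrite -/(dyadic_idx k x) xi => h.
have : (2 ^+ k < i.+1%:R :> R).
  by apply: le_lt_trans h; rewrite -[leLHS]mulr1 ler_pM2l.
by rewrite -natrX ltr_nat ltnS leqNgt ik.
Qed.

Lemma dyadic_itv_unit k i : (i < 2 ^ k)%N -> dyadic_itv k i `<=` unit_itv R.
Proof.
by move=> ik x /(dyadic_itv_lt1 ik)/andP[x0 x1]; rewrite /= in_itv /= x0 ltW.
Qed.

Lemma dyadic_itv00 : dyadic_itv 0 0 = `[0, 1[%classic.
Proof. by rewrite /dyadic_itv expr0 invr1 mul1r add0r. Qed.

End intervals.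

#[local] Hint Resolve measurable_dyadic_itv : core.

Local Notation dnode k i := (Tagged (fun j : nat => 'I_(2 ^ j)) (i : 'I_(2 ^ k))).

(** * Averages and Haar coefficients *)

Section averages.
Context {R : realType}.
Implicit Types (f : R -> R) (N n j k i : nat) (x : R).
Local Notation leb := (@lebesgue_measure R).

Definition dyadic_int f k i : R := \int[leb]_(x in dyadic_itv k i) f x.
Definition dyadic_avg f k i : R := 2 ^+ k * dyadic_int f k i.

Lemma avgE f (I : dyadic) : avg f I = dyadic_avg f (tag I) (tagged I).
Proof. by rewrite /avg /dyadic_avg /dlen invrK. Qed.

Lemma L2_integrable_sqr f : in_L2 f ->
  leb.-integrable (unit_itv R) (EFin \o (fun x => f x ^+ 2)).
Proof.
move=> [mf fy]; apply/integrableP; split.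
  by apply/measurable_EFinP; exact: measurable_funX.
apply: le_lt_trans fy; rewrite le_eqVlt; apply/orP; left; apply/eqP.
by apply: eq_integral => x _ /=; rewrite ger0_norm// sqr_ge0.
Qed.

Lemma unit_fin : (leb (unit_itv R) < +oo)%E.
Proof. by rewrite lebesgue_measure_itv/= lte_fin ltr01 ltry. Qed.

Lemma integrable_cst_unit (c : R) : leb.-integrable (unit_itv R) (EFin \o (fun=> c)).
Proof.
apply: measurable_bounded_integrable => //; first exact: unit_fin.
exact: bounded_cst.
Qed.

Lemma L2_integrable f : in_L2 f -> leb.-integrable (unit_itv R) (EFin \o f).
Proof.
move=> f2; have [mf _] := f2.
have h := @integrableD _ _ _ leb (unit_itv R) (measurable_itv _) _ _
  (integrable_cst_unit 1) (L2_integrable_sqr f2).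
apply: le_integrable h => //; first exact/measurable_EFinP.
move=> x _; rewrite /= lee_fin [leRHS]ger0_norm ?addr_ge0 ?sqr_ge0//.
by rewrite -[X in 1 + X](real_normK (num_real (f x))); have := sqr_ge0 (`|f x| - 1); nra.
Qed.

Lemma dyadic_int_children f k i : (i < 2 ^ k)%N ->
  leb.-integrable (unit_itv R) (EFin \o f) ->
  dyadic_int f k i = dyadic_int f k.+1 i.*2 + dyadic_int f k.+1 i.*2.+1.
Proof.
move=> ik fi; rewrite /dyadic_int dyadic_itv_children Rintegral_setU//.
- exact: measurable_dyadic_itv.
- exact: measurable_dyadic_itv.
- apply: (@integrableS _ _ _ leb (unit_itv R)) => //.
  + by apply: measurableU; exact: measurable_dyadic_itv.
  + by rewrite -dyadic_itv_children; exact: dyadic_itv_unit.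
by apply: dyadic_itv_disjoint; lia.
Qed.

Lemma dyadic_avg_children f k i : (i < 2 ^ k)%N ->
  leb.-integrable (unit_itv R) (EFin \o f) ->
  dyadic_avg f k i = (dyadic_avg f k.+1 i.*2 + dyadic_avg f k.+1 i.*2.+1) / 2.
Proof. by move=> ik fi; rewrite /dyadic_avg dyadic_int_children// exprS; field. Qed.

Lemma dset_minusE k (i : 'I_(2 ^ k)) : dset_minus R (dnode k i) = dyadic_itv k.+1 i.*2.
Proof.
rewrite /dset_minus /dyadic_itv /dleft /dlen /=.
have -> : 2 ^- k * i%:R = 2 ^- k.+1 * i.*2%:R :> R.
  by rewrite exprS invfM -muln2 natrM; field; rewrite expf_neq0.
by rewrite exprS invfM [2 ^- k / 2]mulrC.
Qed.

Lemma dset_plusE k (i : 'I_(2 ^ k)) : dset_plus R (dnode k i) = dyadic_itv k.+1 i.*2.+1.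
Proof.
rewrite /dset_plus /dyadic_itv /dleft /dlen /=.
have e : 2 ^- k * i%:R + 2 ^- k / 2 = 2 ^- k.+1 * i.*2.+1%:R :> R.
  rewrite -(natr1 i.*2) exprS invfM -muln2 natrM; field; rewrite expf_neq0//.
have e' : 2 ^- k * i%:R + 2 ^- k = 2 ^- k.+1 * i.*2.+1%:R + 2 ^- k.+1 :> R.
  by rewrite -e exprS invfM; field; rewrite expf_neq0.
by rewrite e e'.
Qed.

Lemma children_lt k i : (i < 2 ^ k)%N -> (i.*2 < 2 ^ k.+1)%N /\ (i.*2.+1 < 2 ^ k.+1)%N.
Proof. by rewrite expnS mul2n; lia. Qed.

Lemma inner_haarE f j (i : 'I_(2 ^ j)) :
  leb.-integrable (unit_itv R) (EFin \o f) ->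
  inner f (haar (dnode j i)) =
  ((2 ^- j) `^ (- 2^-1)) * (dyadic_int f j.+1 i.*2 - dyadic_int f j.+1 i.*2.+1).
Proof.
move=> fi; rewrite /inner /haar dset_minusE dset_plusE /dlen /=.
have [c1 c2] := children_lt (ltn_ord i).
set c := _ `^ _.
have restr A : measurable A -> A `<=` unit_itv R ->
    leb.-integrable (unit_itv R) (EFin \o (f \* \1_A)) /\
    \int[leb]_(x in unit_itv R) (f \* \1_A) x = \int[leb]_(x in A) f x.
  move=> mA AU; split; last by rewrite -patch_indic -Rintegral_mkcondr (setIidr AU).
  apply: le_integrable (fi) => //.
    apply/measurable_EFinP; apply: measurable_funM; last exact: measurable_indic.
    by apply/measurable_EFinP; exact: (measurable_int leb fi).
  move=> x _; rewrite /= lee_fin normrM ler_piMr//.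
  by rewrite /indic; case: (_ \in _); rewrite ?normr1 ?normr0.
have [i1 e1] := restr _ (measurable_dyadic_itv _ _) (dyadic_itv_unit c1).
have [i2 e2] := restr _ (measurable_dyadic_itv _ _) (dyadic_itv_unit c2).
rewrite /dyadic_int -e1 -e2 -RintegralB// -RintegralZl//.
  by apply: eq_Rintegral => x _ /=; ring.
exact: (@integrableB _ _ _ leb (unit_itv R) (measurable_itv _) _ _ i1 i2).
Qed.

Lemma inner_haar_sqr f j (i : 'I_(2 ^ j)) :
  leb.-integrable (unit_itv R) (EFin \o f) ->
  `|inner f (haar (dnode j i))| ^+ 2 =
  2 ^- j * ((dyadic_avg f j.+1 i.*2 - dyadic_avg f j.+1 i.*2.+1) / 2) ^+ 2.
Proof.
move=> fi; rewrite inner_haarE// real_normK ?num_real// exprMn.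
have -> : ((2 ^- j) `^ (- 2^-1)) ^+ 2 = 2 ^+ j :> R.
  by rewrite powRN exprVn powR12_sqrt// sqr_sqrtr// invrK.
rewrite /dyadic_avg [2 ^+ j.+1]exprS.
have : (2 ^+ j : R) != 0 by rewrite expf_neq0.
by move: (2 ^+ j) => t t0; field.
Qed.

(** An average is the mean of its two children, hence each child differs from
    its parent by half the difference of the siblings, which is a multiple of
    the Haar coefficient. *)
Lemma jump_dyadic_avg f j : leb.-integrable (unit_itv R) (EFin \o f) ->
  jump (dyadic_avg f) j = \sum_(i < 2 ^ j) `|inner f (haar (dnode j i))| ^+ 2.
Proof.
move=> fi; rewrite /jump.
rewrite (sum_children_expn j (fun i => (dyadic_avg f j.+1 i - dyadic_avg f j i./2) ^+ 2)).
rewrite mulr_sumr; apply: eq_bigr => i _.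
rewrite inner_haar_sqr//= uphalf_double doubleK (dyadic_avg_children (ltn_ord i) fi).
by rewrite exprS invfM; field; rewrite expf_neq0.
Qed.

Lemma dyadic_int00 f : leb.-integrable (unit_itv R) (EFin \o f) ->
  dyadic_int f 0 0 = \int[leb]_(x in unit_itv R) f x.
Proof.
move=> fi; rewrite /dyadic_int dyadic_itv00 Rintegral_itv_bndo_bndc//.
apply: (@integrableS _ _ _ leb (unit_itv R)) => //.
by apply: subset_itvl; rewrite bnd_simp.
Qed.

Lemma L2norm2E f : in_L2 f ->
  L2norm2 f = (\int[leb]_(x in unit_itv R) (f x ^+ 2))%:E.
Proof.
move=> f2; rewrite /L2norm2 /Rintegral fineK//.
exact: (@integrable_fin_num _ _ _ leb (unit_itv R) (measurable_itv _) _
  (L2_integrable_sqr f2)).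
Qed.

(** Integrate 2 c f - c^2 <= f^2, where c is the mean of f. *)
Lemma sqr_dyadic_avg00_le f : in_L2 f -> ((dyadic_avg f 0 0 ^+ 2)%:E <= L2norm2 f)%E.
Proof.
move=> f2; have fi := L2_integrable f2; have f2i := L2_integrable_sqr f2.
rewrite L2norm2E// lee_fin /dyadic_avg expr0 mul1r dyadic_int00//.
set c := \int[leb]_(x in _) f x.
have i1 : leb.-integrable (unit_itv R) (EFin \o (fun x => 2 * c * f x)).
  exact: (@integrableZl _ _ _ leb (unit_itv R) (measurable_itv _) (2 * c) _ fi).
have h : 2 * c * c - c ^+ 2 <= \int[leb]_(x in unit_itv R) (f x ^+ 2).
  have -> : 2 * c * c - c ^+ 2 = \int[leb]_(x in unit_itv R) (2 * c * f x - c ^+ 2).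
    rewrite RintegralB//; last exact: integrable_cst_unit.
    rewrite RintegralZl// Rintegral_cst//.
    rewrite [X in fine X](_ : _ = 1%E) /= ?mulr1//.
    by rewrite [LHS]lebesgue_measure_itv /= lte_fin ltr01 -EFinD subr0.
  apply: le_Rintegral => //.
    exact: (@integrableB _ _ _ leb (unit_itv R) (measurable_itv _) _ _ i1
      (integrable_cst_unit (c ^+ 2))).
  by move=> x _; have := sqr_ge0 (f x - c); nra.
by apply: le_trans h; rewrite -mulrA expr2; lra.
Qed.

Definition nodes_below (M : nat) : seq dyadic :=
  [seq dnode j l | j <- iota 0 M, l <- enum 'I_(2 ^ j)].

Lemma mem_nodes_below M I : (I \in nodes_below M) = (tag I < M)%N.
Proof.
apply/allpairsPdep/idP => [[j [i [jM _ ->]]]|IM].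
  by rewrite mem_iota in jM.
by case: I IM => j i jM; exists j, i; rewrite mem_iota mem_enum.
Qed.

Lemma uniq_nodes_below M : uniq (nodes_below M).
Proof.
apply: allpairs_uniq_dep; first exact: iota_uniq.
  by move=> j _; exact: enum_uniq.
by move=> [j i] [j' i'] _ _.
Qed.

Lemma sum_nodes_below M (u : dyadic -> R) :
  \sum_(I <- nodes_below M) u I = \sum_(j < M) \sum_(i < 2 ^ j) u (dnode j i).
Proof.
rewrite big_allpairs_dep -[M in iota 0 M]subn0 -/(index_iota 0 M) big_mkord.
by apply: eq_bigr => j _; rewrite big_enum.
Qed.

Lemma sum_le_esum (T : choiceType) (S : set T) (r : seq T) (u : T -> R) :
  uniq r -> (forall t, t \in r -> S t) ->
  ((\sum_(t <- r) u t)%:E <= \esum_(t in S) (u t)%:E)%E.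
Proof.
move=> ur rS; apply: esum_ge; exists [set` r].
  by split => //; exact: finite_seq.
by rewrite -fsbig_seq// sumEFin.
Qed.

(** Any finite set of dyadic intervals has bounded generation. *)
Lemma esum_dyadic_le (u : dyadic -> R) (B : \bar R) : (forall I, 0 <= u I) ->
  (forall M, ((\sum_(I <- nodes_below M) u I)%:E <= B)%E) ->
  (\esum_(I in [set: dyadic]) (u I)%:E <= B)%E.
Proof.
move=> u0 h; apply: ge_ereal_sup => _ [A [finA _] <-].
have /finite_seqP[r AE] := finA.
pose M := (\max_(I <- r) tag I).+1.
apply: le_trans (h M); rewrite -sumEFin [leRHS]fsbig_seq ?uniq_nodes_below//.
apply: lee_fsum_nneg_subset => [//|||]; first exact: finite_seq.
  move=> I; rewrite AE !inE /= mem_nodes_below ltnS => Ir.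
  exact: leq_bigmax_seq.
by move=> I _; rewrite lee_fin.
Qed.

Lemma dlen_powR (s : R) (I : dyadic) :
  dlen R I `^ (- (2 * s)) = (2 `^ s) ^+ (2 * tag I).
Proof.
rewrite /dlen -powR_inv1// -powRrM mulN1r opprK.
rewrite -[in LHS]powR_mulrn// -[RHS]powR_mulrn ?powR_ge0// -!powRrM.
by congr powR; rewrite natrM; ring.
Qed.

(** The Haar coefficients of generation k give the jump from k to k + 1, whose
    weight is one generation finer: this is the factor p^2. *)
Lemma energy_dyadic_avg_le (s : R) N f : in_L2 f ->
  ((energy (2 `^ s) N (dyadic_avg f))%:E <=
     (Num.max 1 (2 `^ s ^+ 2))%:E * Hnorm2 s f)%E.
Proof.
move=> f2; have fi := L2_integrable f2; set p := 2 `^ s.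
have p0 : 0 <= p by exact: powR_ge0.
have D0 : (0 <= Dsnorm2 s f)%E.
  by apply: esum_ge0 => I _; rewrite lee_fin mulr_ge0// powR_ge0.
have L0 : (0 <= L2norm2 f)%E by apply: integral_ge0 => x _; rewrite lee_fin sqr_ge0.
have m1 : 1 <= Num.max 1 (p ^+ 2) by rewrite le_max lexx.
rewrite /Hnorm2 muleDr ?ge0_adde_def ?inE// /energy EFinD addeC; apply: leeD.
  apply: (@le_trans _ _ ((p ^+ 2)%:E * Dsnorm2 s f)%E); last first.
    by apply: lee_wpmul2r => //; rewrite lee_fin le_max lexx orbT.
  have -> : \sum_(k < N) p ^+ (2 * k.+1) * jump (dyadic_avg f) k = p ^+ 2 *
     \sum_(I <- nodes_below N) dlen R I `^ (- (2 * s)) * `|inner f (haar I)| ^+ 2.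
    rewrite sum_nodes_below mulr_sumr; apply: eq_bigr => k _.
    rewrite jump_dyadic_avg// !mulr_sumr; apply: eq_bigr => i _.
    by rewrite dlen_powR mulnS exprD mulrA.
  rewrite EFinM; apply: lee_wpmul2l; first by rewrite lee_fin exprn_ge0.
  by apply: sum_le_esum; first exact: uniq_nodes_below.
apply: le_trans (sqr_dyadic_avg00_le f2) _.
by rewrite -[leLHS]mul1e; apply: lee_wpmul2r => //; rewrite lee_fin.
Qed.
End averages.

(** * Step functions built from tree functions *)

Section step.
Context {R : realType}.
Implicit Types (f : R -> R) (G : nat -> R) (b : nat -> nat -> R).
Implicit Types (N n j k i : nat) (x : R).
Local Notation leb := (@lebesgue_measure R).

Definition step_fun N G x : R := \sum_(l < 2 ^ N) G l * \1_(dyadic_itv N l) x.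

Lemma step_funE N G i x : (i < 2 ^ N)%N -> dyadic_itv N i x -> step_fun N G x = G i.
Proof.
move=> iN xi; rewrite /step_fun (bigD1 (Ordinal iN))//= big1 ?addr0.
  by rewrite indicE mem_set// mulr1.
move=> l /eqP li; rewrite indicE memNset ?mulr0// => xl; apply: li; apply/val_inj => /=.
by have /dyadic_itvP[_ <-] := xl; have /dyadic_itvP[_ <-] := xi.
Qed.

Lemma measurable_step_fun N G D : measurable_fun D (step_fun N G).
Proof.
rewrite /step_fun; apply: measurable_sum => l; apply: measurable_funM => //.
apply: measurable_indic; exact: measurable_dyadic_itv.
Qed.

Lemma step_fun_L2 N G : in_L2 (step_fun N G).
Proof.
split; first exact: measurable_step_fun.
have /integrableP[_] :
    leb.-integrable (unit_itv R) (EFin \o (fun x => step_fun N G x ^+ 2)).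
  apply: measurable_bounded_integrable => //; first exact: unit_fin.
    by apply: measurable_funX; exact: measurable_step_fun.
  exists ((\sum_(l < 2 ^ N) `|G l|) ^+ 2); split; first exact: num_real.
  move=> M /ltW hM x _ /=.
  apply: le_trans hM; rewrite normrX ler_pXn2r ?nnegrE ?sumr_ge0//.
  apply: le_trans (ler_norm_sum _ _ _) _; apply: ler_sum => l _.
  by rewrite normrM ler_piMr// indicE; case: (_ \in _); rewrite ?normr1 ?normr0.
apply: le_lt_trans; rewrite le_eqVlt; apply/orP; left; apply/eqP.
by apply: eq_integral => x _ /=; rewrite ger0_norm// sqr_ge0.
Qed.

Lemma dyadic_avg_cst f k i (c : R) :
  (forall x, dyadic_itv k i x -> f x = c) -> dyadic_avg f k i = c.
Proof.
move=> fc; rewrite /dyadic_avg /dyadic_int (@eq_Rintegral _ _ _ _ _ (fun=> c)).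
  rewrite Rintegral_cst//; last exact: measurable_dyadic_itv.
  rewrite [X in fine X](lebesgue_dyadic_itv k i) /=.
  by rewrite mulrCA divff ?mulr1// expf_neq0.
by move=> x /[!inE]; exact: fc.
Qed.

(** Backward induction on the generation j: above generation N, both sides are
    means over the two children. *)
Lemma dyadic_avg_step_fun b N n j i : (j + n = N)%N -> (i < 2 ^ j)%N ->
  dyadic_avg (step_fun N (b N)) j i = leaf_avg n b j i.
Proof.
elim: n j i => [|n IHn] j i /= jN ij.
  rewrite addn0 in jN; apply: dyadic_avg_cst => x xj; rewrite -jN.
  exact: step_funE xj.
have [c1 c2] := children_lt ij.
rewrite (dyadic_avg_children ij); last exact/L2_integrable/step_fun_L2.
by rewrite !IHn// -jN addSnnS.
Qed.

Lemma dyadic_idx_coarser N j (x y : R) : (N <= j)%N -> 0 <= x -> 0 <= y ->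
  dyadic_idx j x = dyadic_idx j y -> dyadic_idx N x = dyadic_idx N y.
Proof.
move=> /subnKC <-; move: (j - N)%N => m x0 y0.
elim: m => [|m IHm]; first by rewrite addn0.
rewrite addnS => h; apply: IHm.
by rewrite (dyadic_idx_half _ x0) (dyadic_idx_half _ y0) h.
Qed.

(** The step function is constant on intervals of generation at least N. *)
Lemma inner_step_fun_fine G N j (i : 'I_(2 ^ j)) : (N <= j)%N ->
  inner (step_fun N G) (haar (dnode j i)) = 0.
Proof.
move=> Nj; have [c1 c2] := children_lt (ltn_ord i).
pose y : R := 2 ^- j * i%:R.
have y0 : 0 <= y by rewrite mulr_ge0.
have /dyadic_itvP[_ iy] : dyadic_itv j i y.
  by rewrite /dyadic_itv /= in_itv /= lexx ltrDl exp2V_gt0.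
have h k : dyadic_itv j.+1 k `<=` (dyadic_itv j i : set R) ->
    dyadic_avg (step_fun N G) j.+1 k = G (dyadic_idx N y).
  move=> ks; apply: dyadic_avg_cst => x xk; have xi := ks _ xk.
  have /dyadic_itvP[x0 ix] := xi.
  rewrite -(dyadic_idx_coarser Nj x0 y0) ?ix ?iy//.
  apply: step_funE; last by apply/dyadic_itvP.
  by apply: dyadic_idx_lt; exact: dyadic_itv_lt1 xi.
apply/eqP; rewrite -normr_eq0 -sqrf_eq0 inner_haar_sqr; last first.
  exact/L2_integrable/step_fun_L2.
rewrite !h ?subrr ?mul0r ?expr0n ?mulr0//.
  by move=> x /dyadic_itv_parent; rewrite /= uphalf_double.
by move=> x /dyadic_itv_parent; rewrite doubleK.
Qed.

Lemma inner_step_fun_le b N j (i : 'I_(2 ^ j)) :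
  `|inner (step_fun N (b N)) (haar (dnode j i))| ^+ 2
    <= 2 ^- j * spread b (N - j) (b j i) j i.
Proof.
have [Nj|jN] := leqP N j.
  by rewrite inner_step_fun_fine// normr0 expr0n mulr_ge0// spread_ge0.
have [c1 c2] := children_lt (ltn_ord i).
rewrite inner_haar_sqr; last exact/L2_integrable/step_fun_L2.
have jn : (j.+1 + (N - j.+1) = N)%N by rewrite subnKC.
rewrite !(dyadic_avg_step_fun _ jn)// -(subnSK jN) ler_wpM2l//.
by have := sqr_leaf_avg_sub_le (N - j.+1)%N b (b j i) j i; lra.
Qed.

(** For the jumps: once from the D^s part and twice from the L^2 part, which is
    also responsible for the factor 2 of b(root)^2. *)
Definition hardy_cst (p : R) := 3 * (p - 1) ^- 2 + 2.

Lemma Dsnorm2_step_fun s b N : 1 < 2 `^ s :> R ->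
  (Dsnorm2 s (step_fun N (b N)) <= ((2 `^ s - 1) ^- 2 *
     \sum_(j < N) (2 `^ s) ^+ (2 * j.+1) * jump b j)%:E)%E.
Proof.
set p := 2 `^ s => p1; have p0 : 0 <= p by exact: powR_ge0.
apply: esum_dyadic_le => [I|M]; first by rewrite mulr_ge0// powR_ge0.
rewrite lee_fin; apply: le_trans (sum_osc_le b N p1).
rewrite sum_nodes_below; apply: (@le_trans _ _ (\sum_(j < M) p ^+ (2 * j) * osc b N j)).
  apply: ler_sum => j _; rewrite /osc !mulr_sumr; apply: ler_sum => i _.
  by rewrite dlen_powR ler_wpM2l ?exprn_ge0// inner_step_fun_le.
apply: (@le_trans _ _ (\sum_(j < N + M) p ^+ (2 * j) * osc b N j)).
  rewrite -!(big_mkord predT (fun j => p ^+ (2 * j) * osc b N j)).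
  rewrite [leRHS](@big_cat_nat _ _ _ M)//= ?leq_addl// lerDl sumr_ge0// => j _.
  by rewrite mulr_ge0 ?exprn_ge0 ?osc_ge0.
rewrite big_split_ord/= gerDl big1// => j _.
rewrite /osc big1 ?mulr0// => i _.
by rewrite subnDA subnn sub0n /spread /= subrr expr0n.
Qed.

Lemma L2norm2_step_fun b N :
  L2norm2 (step_fun N (b N)) = (leaf_avg N (fun j i => b j i ^+ 2) 0 0)%:E.
Proof.
rewrite L2norm2E; last exact: step_fun_L2.
rewrite -(@dyadic_avg_step_fun (fun j i => b j i ^+ 2) N N 0 0)//.
rewrite -dyadic_int00; last first.
  exact/L2_integrable_sqr/step_fun_L2.
rewrite /dyadic_avg expr0 mul1r /dyadic_int; congr EFin.
apply: eq_Rintegral => x /[!inE] x01.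
have xN : (dyadic_idx N x < 2 ^ N)%N.
  by apply: dyadic_idx_lt; exact: (@dyadic_itv_lt1 _ 0 0).
have xi : dyadic_itv N (dyadic_idx N x) x.
  by apply/dyadic_itvP; split => //; have /dyadic_itvP[] := x01.
by rewrite !(step_funE _ xN xi).
Qed.

(** The Haar coefficients at generation j < N are bounded by [osc b N j], so the
    Hardy inequality [sum_osc_le] controls the D^s part; its first term also
    controls the distance of the step function to the constant b(root), hence
    the L^2 part. *)
Lemma step_fun_H s b N : 1 < 2 `^ s :> R ->
  in_H s (step_fun N (b N)) /\
  (Hnorm2 s (step_fun N (b N)) <= (hardy_cst (2 `^ s) * energy (2 `^ s) N b)%:E)%E.
Proof.
set p := 2 `^ s => p1.
have h : (Hnorm2 s (step_fun N (b N)) <= (hardy_cst p * energy p N b)%:E)%E.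
  apply: le_trans (leeD (Dsnorm2_step_fun b N p1) (lexx _)) _.
  rewrite L2norm2_step_fun -EFinD lee_fin /energy /hardy_cst -/p.
  have := leaf_avg_sqr_le N b; have := sum_osc_le b N p1.
  have D0 : 0 <= \sum_(j < N) p ^+ (2 * j.+1) * jump b j.
    by apply: sumr_ge0 => j _; rewrite mulr_ge0 ?jump_ge0// exprn_ge0// powR_ge0.
  have : osc b N 0 <= \sum_(j < N) p ^+ (2 * j) * osc b N j.
    case: N {D0} => [|N]; first by rewrite osc_last big_ord0.
    rewrite big_ord_recl/= muln0 expr0 mul1r lerDl sumr_ge0// => j _.
    by rewrite mulr_ge0 ?osc_ge0// exprn_ge0// powR_ge0.
  have q0 : 0 <= (p - 1) ^- 2 by rewrite invr_ge0 sqr_ge0.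
  move: (osc _ _ _) (\sum_(j < N) _) (leaf_avg _ _ _ _) D0 => o X l.
  move: (\sum_(j < N) _) ((p - 1) ^- 2) q0 (b 0%N 0%N) => D q q0 c D0 h1 h2 h3.
  have := mulr_ge0 q0 (sqr_ge0 c); nra.
split => //; split; first exact: step_fun_L2.
by apply: le_lt_trans h _; rewrite ltry.
Qed.
End step.

(** * Maximal dyadic intervals above a level *)

Section stopping.
Context {R : realType}.
Implicit Types (b : nat -> nat -> R) (N n j k i : nat) (x u t : R).

(** [(k, i)] is a maximal interval among those on which |b| exceeds [u]: the
    running maximum crosses the level [u] exactly there. *)
Definition first_above b u k i : bool :=
  (u < branch_max b k i) && (if k is k'.+1 then branch_max b k' i./2 <= u else true).

Lemma first_above_cover b u k (i : 'I_(2 ^ k)) : u < branch_max b k i ->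
  exists J : dyadic, [/\ (tag J <= k)%N, first_above b u (tag J) (tagged J) &
    dset R (dnode k i) `<=` dset R J].
Proof.
elim: k i => [|k IHk] i ui.
  by exists (dnode 0 i); split => //; rewrite /first_above ui.
have [mi|mi] := leP (branch_max b k i./2) u.
  by exists (dnode k.+1 i); split => //; rewrite /first_above ui.
have ik : (i./2 < 2 ^ k)%N.
  by have := ltn_ord i; move: (nat_of_ord i) => l; rewrite expnS mul2n; lia.
have [J [Jk Ju Js]] := IHk (Ordinal ik) mi.
exists J; split => //; first exact: leqW.
exact: subset_trans (@dyadic_itv_parent R k i) Js.
Qed.

Lemma branch_max_le b j k x : 0 <= x -> (j <= k)%N ->
  branch_max b j (dyadic_idx j x) <= branch_max b k (dyadic_idx k x).
Proof.
move=> x0 /subnKC <-; elim: (k - j)%N => [|n IHn]; first by rewrite addn0.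
by apply: le_trans IHn _; rewrite addnS (dyadic_idx_half (j + n) x0) branch_maxS.
Qed.

(** Along a branch the running maximum is nondecreasing, so it crosses a level
    only once: this makes maximal intervals disjoint. *)
Lemma first_above_eq b u x (I J : dyadic) :
  first_above b u (tag I) (tagged I) -> first_above b u (tag J) (tagged J) ->
  dset R I x -> dset R J x -> I = J.
Proof.
wlog IJ : I J / (tag I <= tag J)%N.
  by have [/[swap]|/ltnW/[swap]] := leqP (tag I) (tag J); move=> h ? ? ? ? ?;
    [|symmetry]; apply: h.
case: I J IJ => [j i] [k l] /= jk uI uJ /dyadic_itvP[x0 /= xi] /dyadic_itvP[_ /= xl].
move: jk; rewrite leq_eqVlt => /orP[/eqP jk|jk].
  move: l uJ xl; rewrite -jk => l uJ xl; congr existT.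
  by apply/val_inj; rewrite /= -xi -xl.
move: uI uJ; rewrite /first_above -xi -xl => /andP[ui _] /andP[_].
case: k l xl jk => // k l xl jk; rewrite -(dyadic_idx_half k x0) => mk.
have := lt_le_trans ui (@branch_max_le b j k x x0 jk).
by rewrite ltNge mk.
Qed.
End stopping.

(** * Slicing finitely many values by powers of two *)

Section scales.
Context {R : realType}.

Lemma exists_lower_scale (T : eqType) (r : seq T) (F : T -> R) :
  exists2 e : R, 0 < e & forall y, y \in r -> F y != 0 -> 2 * e < `|F y|.
Proof.
elim: r => [|y r [e e0 he]]; first by exists 1.
have [Fy|Fy] := eqVneq (F y) 0.
  by exists e => // z; rewrite inE => /orP[/eqP ->|/he//]; rewrite Fy eqxx.
exists (Num.min e (`|F y| / 3)).
  by rewrite lt_min e0 divr_gt0 ?normr_gt0.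
move=> z; rewrite inE => /orP[/eqP -> _|/he h /h].
  apply: (@le_lt_trans _ _ (2 * (`|F y| / 3))).
    by rewrite ler_pM2l// ge_min lexx orbT.
  have : 0 < `|F y| by rewrite normr_gt0.
  by lra.
by apply: le_lt_trans; rewrite ler_pM2l// ge_min lexx.
Qed.

Lemma exists_scales (T : eqType) (r : seq T) (F : T -> R) :
  exists (e : R) (n : nat), 0 < e /\
    forall y, y \in r -> F y != 0 -> 2 * e < `|F y| <= 2 * e * 2 ^+ n.
Proof.
have [e e0 he] := exists_lower_scale r F.
pose B := \sum_(y <- r) `|F y|.
exists e, (Num.truncn (B / (2 * e))).+1; split => // y yr Fy; rewrite he//=.
apply: (@le_trans _ _ B).
  by rewrite /B (big_rem y)//= lerDl sumr_ge0.
rewrite -ler_pdivrMl ?mulr_gt0// mulrC.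
have := truncnS_gt (B / (2 * e)); set m := (Num.truncn _).+1 => /ltW h.
by apply: le_trans h _; rewrite -natrX ler_nat ltnW// ltn_expl.
Qed.

(** The largest r with 2 e 2^r < |x| already gives |x| <= 4 e 2^r. *)
Lemma sqr_le_scales (e : R) n x : 0 < e ->
  (x != 0 -> 2 * e < `|x| <= 2 * e * 2 ^+ n) ->
  x ^+ 2 <= \sum_(r < n)
    (if 2 * (e * 2 ^+ r) < `|x| then 16 * (e * 2 ^+ r) ^+ 2 else 0).
Proof.
move=> e0; have [->|x0 /(_ isT)/andP[x1 x2]] := eqVneq x 0.
  move=> _; rewrite expr0n sumr_ge0// => r _; case: ifP => // _.
  by rewrite mulr_ge0// sqr_ge0.
elim: n x2 => [|n IHn] x2.
  by move: x2; rewrite expr0 mulr1 leNgt x1.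
rewrite big_ord_recr/=; case: ltP => [_|h].
  rewrite -[leLHS]add0r lerD//.
    by apply: sumr_ge0 => r _; case: ifP => // _; rewrite mulr_ge0// sqr_ge0.
  rewrite -(real_normK (num_real x)).
  have -> : 16 * (e * 2 ^+ n) ^+ 2 = (4 * (e * 2 ^+ n)) ^+ 2 by ring.
  rewrite ler_pXn2r ?nnegrE ?mulr_ge0 ?exprn_ge0 ?(ltW e0)//.
  by apply: le_trans x2 _; rewrite exprS; lra.
by rewrite addr0; apply: IHn; rewrite -mulrA.
Qed.
End scales.

(** * Capacity and the Carleson condition *)

Section capacity.
Context {R : realType}.
Implicit Types (N n : nat) (x u t : R).
Local Notation leb := (@lebesgue_measure R).

Lemma ae_imply (P Q : set R) : (forall x, P x -> Q x) ->
  {ae leb, forall x, P x} -> {ae leb, forall x, Q x}.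
Proof.
move=> PQ [A [mA A0 PA]]; exists A; split => //.
by move=> x nQ; apply: PA => Px; apply: nQ; exact: PQ.
Qed.

Lemma Hnorm2_ge0 (s : R) f : (0 <= Hnorm2 s f)%E.
Proof.
rewrite adde_ge0//; last by apply: integral_ge0 => x _; rewrite lee_fin sqr_ge0.
by apply: esum_ge0 => I _; rewrite lee_fin mulr_ge0// powR_ge0.
Qed.

Lemma L2norm2_le_Hnorm2 (s : R) f : (L2norm2 f <= Hnorm2 s f)%E.
Proof.
rewrite leeDr//; apply: esum_ge0 => I _.
by rewrite lee_fin mulr_ge0// powR_ge0.
Qed.

Lemma avg_ge1 f (J : dyadic) : in_L2 f ->
  {ae leb, forall x, dset R J x -> 1 <= f x} -> 1 <= avg f J.
Proof.
move=> f2 f1; rewrite avgE; case: J f1 => j i /= f1.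
have mJ := @measurable_dyadic_itv R j i.
have JU := @dyadic_itv_unit R j i (ltn_ord i).
have mf : measurable_fun (dyadic_itv j i) f.
  by apply: measurable_funS (f2.1) => //; exact: measurable_itv.
have mg : measurable_fun (dyadic_itv j i) (fun x => Num.max 1 (f x)).
  exact: measurable_maxr.
have fi : leb.-integrable (dyadic_itv j i) (EFin \o f).
  by apply: (@integrableS _ _ _ leb (unit_itv R)) => //; exact: L2_integrable.
(* On J the function f agrees almost everywhere with max(1, f), which is at
   least 1 everywhere. *)
have eqfg : ae_eq leb (dyadic_itv j i) (EFin \o f) (EFin \o (fun x => Num.max 1 (f x))).
  apply: ae_imply f1 => x h /h fx1; rewrite /=; congr EFin.
  by rewrite max_r.
have : ((2 ^- j)%:E <= \int[leb]_(x in dyadic_itv j i) (f x)%:E)%E.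
  have -> : (\int[leb]_(x in dyadic_itv j i) (f x)%:E =
      \int[leb]_(x in dyadic_itv j i) (Num.max 1 (f x))%:E)%E.
    by apply: ae_eq_integral => //; exact/measurable_EFinP.
  rewrite -(lebesgue_dyadic_itv j i) -[leLHS]mul1e -integral_cst//.
  apply: ge0_le_integral => //.
  - exact/measurable_EFinP.
  - by move=> x _; rewrite lee_fin le_max lexx.
have fin := @integrable_fin_num _ _ _ leb _ mJ _ fi.
rewrite /dyadic_avg /dyadic_int /Rintegral -[X in (_ <= X)%E](fineK fin) lee_fin => h.
by rewrite -(ler_pM2l (exp2V_gt0 j)) mulr1 mulKf// expf_neq0.
Qed.

(** A competitor for E has squared L^2 norm at least the length of any dyadic
    interval contained in E. *)
Lemma Cap_gt0 (s : R) (J : dyadic) (E : set R) : dset R J `<=` E ->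
  (0 < Cap s E)%E.
Proof.
move=> JE; apply: (@lt_le_trans _ _ (2 ^- tag J)%:E).
  by rewrite lte_fin exp2V_gt0.
apply: le_ereal_inf_tmp => _ [f [[f2 _] f1] <-].
apply: le_trans (L2norm2_le_Hnorm2 s f).
case: J JE => j i /= JE.
have mJ := @measurable_dyadic_itv R j i.
have JU := @dyadic_itv_unit R j i (ltn_ord i).
have mf : measurable_fun (unit_itv R) (fun x => (f x ^+ 2)%:E).
  by apply/measurable_EFinP; apply: measurable_funX; exact: f2.1.
apply: (@le_trans _ _ (\int[leb]_(x in dyadic_itv j i) (f x ^+ 2)%:E)%E); last first.
  by apply: ge0_subset_integral => // x _; rewrite lee_fin sqr_ge0.
rewrite -(lebesgue_dyadic_itv j i) -[leLHS]mul1e -integral_cst//.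
apply: ae_ge0_le_integral => //.
- by move=> x _; rewrite lee_fin sqr_ge0.
- exact: measurable_funS mf.
- apply: ae_imply f1 => x h xJ; rewrite lee_fin.
  have fx1 := h (JE _ xJ); rewrite expr_ge1//; exact: le_trans fx1.
Qed.

Lemma Cap_le (s : R) (E : set R) f : in_H s f ->
  (forall x, E x -> 1 <= f x) -> (Cap s E <= Hnorm2 s f)%E.
Proof.
move=> fH f1; apply: ereal_inf_lbound; exists f => //; split => //.
exact: aeW.
Qed.

Lemma dset_unit (I : dyadic) : dset R I `<=` `[0, 1[%classic.
Proof.
case: I => j i x /(dyadic_itv_lt1 (ltn_ord i)).
by rewrite /= in_itv.
Qed.

(** The constant 1 is a competitor for every union of dyadic intervals. *)
Lemma Cap_fin (s : R) n (I : 'I_n.+1 -> dyadic) : 1 < 2 `^ s :> R ->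
  exists2 c : R, 0 < c & Cap s (\bigcup_k dset R (I k)) = c%:E.
Proof.
move=> p1; set E := \bigcup_k _.
have E0 : (0 < Cap s E)%E by apply: (@Cap_gt0 s (I ord0)) => x ?; exists ord0.
have [fH Hf] := @step_fun_H R s (fun _ _ => 1) 0 p1.
have Ey : (Cap s E < +oo)%E.
  apply: le_lt_trans (fH.2); apply: Cap_le => // x [k _ /dset_unit].
  rewrite /= in_itv /= => x01; rewrite (@step_funE _ _ _ 0)//.
  by rewrite dyadic_itv00 /= in_itv.
move: E0 Ey; case: (Cap s E) => // c; rewrite lte_fin => c0 _.
by exists c.
Qed.

(** The Carleson condition with the capacity multiplied out and no square root:
    here [K] stands for the squared Carleson norm. *)
Definition carleson_bound (s : R) (mu : dyadic -> R) (K : R) : Prop :=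
  forall (n : nat) (I : 'I_n.+1 -> dyadic),
    trivIset setT (fun k => dset R (I k)) ->
    (\sum_(k < n.+1) \esum_(J in dsub R (I k)) (mu J)%:E
       <= K%:E * Cap s (\bigcup_k dset R (I k)))%E.

(** The capacity of a nonempty finite union of dyadic intervals is positive and
    finite, so it may be moved to the other side. *)
Lemma sCnorm_leP (s : R) (mu : dyadic -> R) (r : R) : 1 < 2 `^ s :> R ->
  (forall I, 0 <= mu I) -> 0 <= r ->
  (sCnorm s mu <= r%:E)%E <-> carleson_bound s mu (r ^+ 2).
Proof.
move=> p1 mu0 r0.
have key n (I : 'I_n.+1 -> dyadic) :
    ((((Cap s (\bigcup_k dset R (I k)))^-1 *
      \sum_(k < n.+1) \esum_(J in dsub R (I k)) (mu J)%:E) `^ 2^-1) <= r%:E)%E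
    <-> (\sum_(k < n.+1) \esum_(J in dsub R (I k)) (mu J)%:E
       <= (r ^+ 2)%:E * Cap s (\bigcup_k dset R (I k)))%E.
  have [c c0 ->] := Cap_fin I p1.
  have : (0 <= \sum_(k < n.+1) \esum_(J in dsub R (I k)) (mu J)%:E)%E.
    by apply: sume_ge0 => k _; apply: esum_ge0 => J _; rewrite lee_fin.
  move: (\sum_(k < n.+1) _)%E => S S0.
  rewrite inver gt_eqF// [X in _ <-> (_ <= X)%E]muleC -lee_pdivrMl//.
  have : (0 <= c^-1%:E * S)%E by rewrite mule_ge0// lee_fin invr_ge0 ltW.
  case: (c^-1%:E * S)%E => [y|_|//].
    rewrite lee_fin => y0; rewrite poweR_EFin !lee_fin powR12_sqrt//.
    rewrite -[in X in X <-> _](ger0_norm r0) -sqrtr_sqr ler_sqrt ?sqr_ge0//.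
  by rewrite poweRyr// invr_eq0.
split=> [h n I tI|h].
  by apply/key; apply: le_trans h; apply: ereal_sup_ubound; exists n, I.
by apply: ge_ereal_sup => _ [n [I [tI ->]]]; apply/key; exact: h.
Qed.

(** A dyadic interval lies below at most one of the disjoint intervals [I k], and
    there the average of a competitor is at least 1. *)
Lemma carleson_bound_of_embedding (s : R) (mu : dyadic -> R) (C : R) :
  1 < 2 `^ s :> R ->
  (forall I, 0 <= mu I) -> embedding s mu C -> 0 <= C /\ carleson_bound s mu C.
Proof.
move=> p1 mu0 emb.
have key n (I : 'I_n.+1 -> dyadic) f : trivIset setT (fun k => dset R (I k)) ->
    in_H s f -> {ae leb, forall x, (\bigcup_k dset R (I k)) x -> 1 <= f x} ->
    (\sum_(k < n.+1) \esum_(J in dsub R (I k)) (mu J)%:E <= C%:E * Hnorm2 s f)%E.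
  move=> tI fH f1; apply: le_trans (emb f fH).
  under eq_bigr do rewrite esum_mkcond.
  rewrite -esum_sum; last by move=> J k _ _; case: ifP => //; rewrite lee_fin.
  apply: le_esum => J _.
  have [[k Jk]|noJ] := pselect (exists k, dsub R (I k) J); last first.
    rewrite big1; first by rewrite lee_fin mulr_ge0// sqr_ge0.
    move=> k _.
    by rewrite memNset// => Jk; apply: noJ; exists k.
  rewrite (bigD1 k)//= mem_set// big1 ?adde0; last first.
    move=> l lk; rewrite memNset// => Jl; move/eqP: lk; apply.
    have Jx : dset R J (dleft R J).
      by rewrite /dset /= in_itv /= lexx ltrDl /dlen exp2V_gt0.
    by apply: tI => //; exists (dleft R J); split; [exact: Jl|exact: Jk].
  rewrite lee_fin ler_peMl// exprn_ege1//; apply: avg_ge1; first exact: fH.1.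
  by apply: ae_imply f1 => x h xJ; apply: h; exists k => //; exact: Jk.
have [one_H _] := @step_fun_H R s (fun _ _ => 1) 0 p1.
set one := step_fun 0 _ in one_H.
have one_ge1 x : `[0, 1[%classic x -> 1 <= one x.
  move=> x01; rewrite /one (@step_funE _ _ _ 0)//.
  by rewrite dyadic_itv00.
have [h h0 hE] : exists2 h : R, 0 < h & Hnorm2 s one = h%:E.
  have [c c0 capE] := @Cap_fin s 0
    (fun=> Tagged (fun j => 'I_(2 ^ j)) (Ordinal (isT : (0 < 2 ^ 0)%N))) p1.
  have : (c%:E <= Hnorm2 s one)%E.
    by rewrite -capE; apply: Cap_le => // x [k _ /dset_unit]; exact: one_ge1.
  case: (Hnorm2 s one) one_H.2 => [h _|//|//]; rewrite lee_fin => ch.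
  by exists h => //; exact: lt_le_trans ch.
have C0 : 0 <= C.
  have : (0 <= C%:E * Hnorm2 s one)%E.
    apply: le_trans (emb _ one_H); apply: esum_ge0 => J _.
    by rewrite lee_fin mulr_ge0// sqr_ge0.
  by rewrite hE -EFinM lee_fin pmulr_lge0.
split => // n I tI.
(* For C = 0 one competitor of finite norm suffices; otherwise divide by C. *)
have [C00|Cn0] := eqVneq C 0.
  have -> : (C%:E * Cap s (\bigcup_k dset R (I k)) = C%:E * Hnorm2 s one)%E.
    by rewrite C00 !mul0e.
  apply: key => //.
  by apply: aeW => x [k _ /dset_unit]; exact: one_ge1.
have Cp : 0 < C by rewrite lt_neqAle eq_sym Cn0.
rewrite -lee_pdivrMl//; apply: le_ereal_inf_tmp => _ [f [fH f1] <-].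
by rewrite lee_pdivrMl//; exact: key.
Qed.
End capacity.

(** * The embedding inequality *)

Section embedding.
Context {R : realType}.
Implicit Types (N n : nat) (x u t : R) (a : nat -> nat -> R).

(** The maximal intervals above the level [u], enumerated as the Carleson
    condition requires. *)
Lemma exists_covering_family a u N :
  has (fun I : dyadic => u < `|a (tag I) (tagged I)|) (nodes_below N.+1) ->
  exists (n : nat) (F : 'I_n.+1 -> dyadic),
    [/\ trivIset setT (fun k => dset R (F k)),
        forall k, (tag (F k) <= N)%N /\ u < branch_max a (tag (F k)) (tagged (F k)) &
        forall I, I \in nodes_below N.+1 -> u < `|a (tag I) (tagged I)| ->
          exists k, dset R I `<=` dset R (F k)].
Proof.
move=> hasI.
pose T := [seq I : dyadic <- nodes_below N.+1 | first_above a u (tag I) (tagged I)].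
have cover I : I \in nodes_below N.+1 -> u < `|a (tag I) (tagged I)| ->
    exists2 J, J \in T & dset R I `<=` dset R J.
  rewrite mem_nodes_below ltnS; case: I => k i /= kN ui.
  have [J [Jk Ju Js]] := first_above_cover (lt_le_trans ui (branch_max_ge a k i)).
  exists J => //; rewrite mem_filter Ju mem_nodes_below ltnS.
  exact: leq_trans kN.
have [I IN uI] := hasP hasI; have [J JT _] := cover I IN uI.
have T0 : (0 < size T)%N by case: T JT {cover}.
have sT : (size T).-1.+1 = size T by rewrite prednK.
have lt_T (k : 'I_(size T).-1.+1) : (k < size T)%N.
  by rewrite -[X in (_ < X)%N]sT ltn_ord.
exists (size T).-1, (fun k => nth J T k); split.
- move=> k l _ _ [x [xk xl]]; apply/val_inj/eqP => /=.
  have [kT lT] := (lt_T k, lt_T l).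
  rewrite -(nth_uniq J kT lT) ?filter_uniq ?uniq_nodes_below//; apply/eqP.
  have := mem_nth J kT; rewrite mem_filter => /andP[uk _].
  have := mem_nth J lT; rewrite mem_filter => /andP[ul _].
  exact: first_above_eq uk ul xk xl.
- move=> k; have kT := lt_T k.
  have := mem_nth J kT; rewrite mem_filter mem_nodes_below ltnS => /andP[+ ->].
  by case/andP.
- move=> L LN uL; have [M MT LM] := cover L LN uL.
  have iM : (index M T < (size T).-1.+1)%N by rewrite sT index_mem.
  by exists (Ordinal iM); rewrite /= nth_index.
Qed.

Lemma sum_covered_le (mu : dyadic -> R) (P : pred dyadic) N n (F : 'I_n.+1 -> dyadic) :
  (forall I, 0 <= mu I) ->
  (forall I, I \in nodes_below N -> P I -> exists k, dset R I `<=` dset R (F k)) ->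
  ((\sum_(I <- nodes_below N | P I) mu I)%:E
    <= \sum_(k < n.+1) \esum_(J in dsub R (F k)) (mu J)%:E)%E.
Proof.
move=> mu0 cov.
apply: (@le_trans _ _ (\sum_(k < n.+1)
    \sum_(I <- [seq I <- nodes_below N | I \in dsub R (F k)]) mu I)%:E).
  rewrite lee_fin; under [leRHS]eq_bigr do rewrite big_filter big_mkcond/=.
  rewrite exchange_big/= big_mkcond/= big_seq [leRHS]big_seq.
  apply: ler_sum => I IN; case: ifP => PI; last first.
    by apply: sumr_ge0 => k _; case: ifP.
  have [k Ik] := cov I IN PI.
  rewrite (bigD1 k)//= mem_set// lerDl sumr_ge0// => l _.
  by case: ifP.
rewrite -sumEFin; apply: lee_sum => k _; apply: sum_le_esum.
  by rewrite filter_uniq// uniq_nodes_below.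
by move=> I; rewrite mem_filter => /andP[/set_mem].
Qed.

(** The slice of the running maximum at [t], divided by [t], is 1 on every
    maximal interval above the level 2t: its step function is the competitor for
    the capacity. *)
Lemma level_mass_le (s : R) (mu : dyadic -> R) (K : R) N a t :
  1 < 2 `^ s :> R -> (forall I, 0 <= mu I) -> 0 <= K ->
  carleson_bound s mu K -> 0 < t ->
  \sum_(I <- nodes_below N.+1 | 2 * t < `|a (tag I) (tagged I)|) mu I <=
  K * (hardy_cst (2 `^ s) *
    (t^-1 ^+ 2 * energy (2 `^ s) N (fun k i => slice t (branch_max a k i)))).
Proof.
move=> p1 mu0 K0 test t0; rewrite -energyZ; set b := fun k i => _ * _.
have [gH gle] := step_fun_H b N p1; set g := step_fun N _ in gH gle.
have [hasI|noI] := boolP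
    (has (fun I : dyadic => 2 * t < `|a (tag I) (tagged I)|) (nodes_below N.+1));
  last first.
  rewrite big1_seq; last first.
    by move=> I /andP[uI IN]; case/negP: noI; apply/hasP; exists I.
  rewrite mulr_ge0// -lee_fin; apply: le_trans gle; exact: Hnorm2_ge0.
have [n [F [trivF Fu cov]]] := exists_covering_family hasI.
rewrite -lee_fin; apply: le_trans (sum_covered_le mu0 cov) _.
apply: le_trans (test n F trivF) _.
rewrite EFinM; apply: lee_wpmul2l; first by rewrite lee_fin.
apply: le_trans gle; apply: Cap_le => // x [k _ xk].
have [FN ut] := Fu k; move: (F k) FN ut xk => [j i] /= jN ut xj.
have xN : (dyadic_idx N x < 2 ^ N)%N by apply: dyadic_idx_lt; exact: dyadic_itv_lt1 xj.
have /dyadic_itvP[x0 xi] := xj.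
rewrite /g (step_funE _ xN); last by apply/dyadic_itvP.
rewrite /b slice_top// ?mulVf ?gt_eqF//.
apply: ltW; apply: lt_le_trans ut _; rewrite -xi; exact: branch_max_le.
Qed.

(** The factors come from [sqr_le_scales], [step_fun_H] and
    [energy_dyadic_avg_le]. *)
Definition embedding_cst (p : R) := 16 * hardy_cst p * Num.max 1 (p ^+ 2).

Lemma hardy_cst_gt0 (p : R) : 0 < hardy_cst p.
Proof. by rewrite ltr_wpDl// mulr_ge0// invr_ge0 sqr_ge0. Qed.

Lemma embedding_cst_gt0 (p : R) : 0 < embedding_cst p.
Proof.
by rewrite mulr_gt0 ?mulr_gt0 ?hardy_cst_gt0// lt_max ltr01.
Qed.

(** Capacitary strong type inequality, for tree functions. Only finitely many
    intervals occur, so finitely many slices reach all the nonzero values. *)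
Lemma sum_sqr_tree_le (s : R) (mu : dyadic -> R) (K : R) N a :
  1 < 2 `^ s :> R -> (forall I, 0 <= mu I) -> 0 <= K -> carleson_bound s mu K ->
  \sum_(I <- nodes_below N.+1) a (tag I) (tagged I) ^+ 2 * mu I <=
  16 * hardy_cst (2 `^ s) * K * energy (2 `^ s) N a.
Proof.
move=> p1 mu0 K0 test; set p := 2 `^ s; have p0 : 0 <= p by exact: powR_ge0.
pose aa (I : dyadic) : R := a (tag I) (tagged I).
have [e [n [e0 he]]] := exists_scales (nodes_below N.+1) aa.
pose t r : R := e * 2 ^+ r.
have t0 r : 0 < t r by rewrite mulr_gt0// exprn_gt0.
apply: (@le_trans _ _ (\sum_(r < n) 16 * t r ^+ 2 *
    \sum_(I <- nodes_below N.+1 | 2 * t r < `|aa I|) mu I)).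
  under [leRHS]eq_bigr do rewrite mulr_sumr big_mkcond/=.
  rewrite exchange_big/= big_seq [leRHS]big_seq; apply: ler_sum => I IN.
  apply: le_trans (ler_wpM2r (mu0 I) (sqr_le_scales e0 (he I IN))) _.
  rewrite mulr_suml; apply: ler_sum => r _.
  by case: ifP => //; rewrite mul0r.
apply: (@le_trans _ _ (\sum_(r < n) 16 * hardy_cst p * K *
    energy p N (fun k i => slice (t r) (branch_max a k i)))).
  apply: ler_sum => r _.
  have := level_mass_le N a p1 mu0 K0 test (t0 r); rewrite -/p.
  set E := energy _ _ _ => h.
  have q0 : 0 <= 16 * t r ^+ 2 by rewrite mulr_ge0// sqr_ge0.
  apply: le_trans (ler_wpM2l q0 h) _.
  rewrite le_eqVlt; apply/orP; left; apply/eqP.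
  by field; rewrite gt_eqF.
rewrite -mulr_sumr; apply: ler_wpM2l.
  by rewrite mulr_ge0// mulr_ge0// ltW// hardy_cst_gt0.
apply: le_trans (energy_branch_max N a p0).
apply: (@energy_sum_le _ p N n (fun r k i => slice (t r) (branch_max a k i))) => //;
  last by move=> k i; exact: sum_slice_lipschitz.
have := sum_slice_lipschitz n (branch_max a 0 0) 0 e0.
rewrite subr0; apply: le_trans; apply: ler_sum => r _.
by rewrite slice0 ?subr0//; exact: t0.
Qed.

Lemma embedding_of_carleson_bound (s : R) (mu : dyadic -> R) (K : R) :
  1 < 2 `^ s :> R -> (forall I, 0 <= mu I) -> 0 <= K -> carleson_bound s mu K ->
  embedding s mu (embedding_cst (2 `^ s) * K).
Proof.
move=> p1 mu0 K0 test f fH; set p := 2 `^ s.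
apply: esum_dyadic_le => [I|[|N]]; first by rewrite mulr_ge0// sqr_ge0.
  rewrite big_nil mule_ge0 ?Hnorm2_ge0// lee_fin mulr_ge0//.
  exact/ltW/embedding_cst_gt0.
under eq_bigr do rewrite avgE.
apply: le_trans (_ : (_ <= (16 * hardy_cst p * K * energy p N (dyadic_avg f))%:E)%E) _.
  by rewrite lee_fin; exact: sum_sqr_tree_le.
have -> : embedding_cst p * K = 16 * hardy_cst p * K * Num.max 1 (p ^+ 2).
  by rewrite /embedding_cst; ring.
rewrite [X in (_ <= X * _)%E]EFinM -muleA EFinM.
apply: lee_wpmul2l; last exact: energy_dyadic_avg_le fH.1.
by rewrite lee_fin mulr_ge0// mulr_ge0// ltW// hardy_cst_gt0.
Qed.

Lemma sCnorm_ge0 (s : R) (mu : dyadic -> R) : (0 <= sCnorm s mu)%E.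
Proof.
apply: le_ereal_sup_tmp.
pose root : dyadic := Tagged (fun j => 'I_(2 ^ j)) (Ordinal (isT : (0 < 2 ^ 0)%N)).
eexists.
  exists 0%N, (fun=> root); split; last by reflexivity.
  by move=> k l _ _ _; rewrite (ord1 k) (ord1 l).
exact: poweR_ge0.
Qed.
End embedding.

Theorem theorem3p1 (R : realType) (s : R) (hs : 0 < s < 1) :
  (forall mu : dyadic -> R, (forall I, 0 <= mu I) ->
     ((exists C : R, embedding s mu C) <-> is_sCarleson s mu)) /\
  (exists c1 c2 : R, 0 < c1 /\ 0 < c2 /\
     forall mu : dyadic -> R, (forall I, 0 <= mu I) ->
       (c1%:E * best_const s mu <= sCnorm s mu ^+ 2)%E /\
       (sCnorm s mu ^+ 2 <= c2%:E * best_const s mu)%E).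
Proof.
have p1 : 1 < 2 `^ s :> R.
  have /andP[s0 _] := hs.
  have ln2 : 0 < ln 2 :> R by rewrite ln_gt0// ltr1n.
  by rewrite /powR pnatr_eq0 /= expR_gt1 mulr_gt0.
pose A := embedding_cst (2 `^ s); have A0 : 0 < A by exact: embedding_cst_gt0.
have easy (mu : dyadic -> R) C : (forall I, 0 <= mu I) -> embedding s mu C ->
    0 <= C /\ (sCnorm s mu <= (Num.sqrt C)%:E)%E.
  move=> mu0 /(carleson_bound_of_embedding p1 mu0)[C0 test]; split => //.
  by apply/(sCnorm_leP p1 mu0) => //; rewrite sqr_sqrtr.
have hard (mu : dyadic -> R) r : (forall I, 0 <= mu I) -> sCnorm s mu = r%:E ->
    embedding s mu (A * r ^+ 2).
  move=> mu0 mur; apply: embedding_of_carleson_bound => //; first exact: sqr_ge0.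
  have r0 : 0 <= r by rewrite -lee_fin -mur sCnorm_ge0.
  by apply/(sCnorm_leP p1 mu0) => //; rewrite mur.
have sC_real (mu : dyadic -> R) : (sCnorm s mu < +oo)%E -> exists r, sCnorm s mu = r%:E.
  by move: (sCnorm_ge0 s mu); case: (sCnorm s mu) => // r _ _; exists r.
split=> [mu mu0|]; first split=> [[C /(easy _ _ mu0)[_ h]]|/sC_real[r mur]].
- by apply: le_lt_trans h _; rewrite ltry.
- by exists (A * r ^+ 2); exact: hard.
exists A^-1, 1; rewrite invr_gt0 A0; split => //; split => // mu mu0; split.
  rewrite lee_pdivrMl//.
  have [/eqP mu_y|] := eqVneq (sCnorm s mu) +oo%E.
    by rewrite (eqP mu_y) expe2 mulyy gt0_muley ?lte_fin// leey.
  rewrite -ltey => /sC_real[r mur].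
  rewrite mur -EFin_expe -EFinM; apply: ereal_inf_lbound.
  by exists (A * r ^+ 2) => //; exact: hard.
rewrite mul1e; apply: le_ereal_inf_tmp => _ [C embC <-].
have [C0 h] := easy _ _ mu0 embC.
have [r mur] : exists r, sCnorm s mu = r%:E.
  by apply: sC_real; apply: le_lt_trans h _; rewrite ltry.
have r0 : 0 <= r by rewrite -lee_fin -mur sCnorm_ge0.
move: h; rewrite mur lee_fin -EFin_expe lee_fin => h.
by rewrite -(sqr_sqrtr C0) ler_pXn2r ?nnegrE ?sqrtr_ge0.
Qed.
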